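(* Let $(A,\prec,\succ)$ be a noncommutative Novikov algebra, $(V,\ell_\prec,r_\prec,\ell_\succ,r_\succ)$ a representation of $(A,\prec,\succ)$, and $T:V\to A$ an $\mathcal O$-operator of $(A,\prec,\succ)$ associated to $(V,\ell_\prec,r_\prec,\ell_\succ,r_\succ)$. Then the operations $$u\lhd_1v=\ell_\prec(T(u))v,\quad u\lhd_2v=r_\prec(T(v))u,\quad u\rhd_1v=\ell_\succ(T(u))v,\quad u\rhd_2v=r_\succ(T(v))u,\qquad u,v\in V,$$ make $(V,\lhd_1,\lhd_2,\rhd_1,\rhd_2)$ a noncommutative pre-Novikov algebra.
   Context: $\mathbf k$ is a field of characteristic $0$; all vector spaces are finite-dimensional over $\mathbf k$. A noncommutative Novikov algebra is a vector space $A$ with bilinear operations $\prec,\succ$ such that, with $\bullet:=\prec+\succ$, $(x\succ y)\prec z=x\succ(y\prec z)$ and $(x\prec y)\bullet z=x\bullet(y\succ z)$ for all $x,y,z\in A$. A representation of $(A,\prec,\succ)$ is $(V,\ell_\prec,r_\prec,\ell_\succ,r_\succ)$ with $V$ a vector space and linear maps $\ell_\prec,r_\prec,\ell_\succ,r_\succ:A\to\mathrm{End}(V)$ such that, with $\ell_\bullet=\ell_\prec+\ell_\succ$, $r_\bullet=r_\prec+r_\succ$, for all $x,y\in A$: $\ell_\prec(x\succ y)=\ell_\succ(x)\ell_\prec(y)$; $r_\prec(x)\ell_\succ(y)=\ell_\succ(y)r_\prec(x)$; $r_\prec(x)r_\succ(y)=r_\succ(y\prec x)$; $\ell_\bullet(x\prec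 y)=\ell_\bullet(x)\ell_\succ(y)$; $r_\bullet(x)\ell_\prec(y)=\ell_\bullet(y)r_\succ(x)$; $r_\bullet(x)r_\prec(y)=r_\bullet(y\succ x)$. A linear map $T:V\to A$ is an $\mathcal O$-operator of $(A,\prec,\succ)$ associated to $(V,\ell_\prec,r_\prec,\ell_\succ,r_\succ)$ if $T(u)*T(v)=T\big(\ell_*(T(u))v+r_*(T(v))u\big)$ for all $u,v\in V$ and $*\in\{\prec,\succ\}$. A noncommutative pre-Novikov algebra is a vector space with bilinear operations $\lhd_1,\lhd_2,\rhd_1,\rhd_2$ such that, with $\prec:=\lhd_1+\lhd_2$ and $\succ:=\rhd_1+\rhd_2$, for all $x,y,z$: $(x\succ y)\lhd_1z=x\rhd_1(y\lhd_1z)$; $(x\rhd_1y)\lhd_2z=x\rhd_1(y\lhd_2z)$; $(x\rhd_2y)\lhd_2z=x\rhd_2(y\prec z)$; $(x\prec y)\lhd_1z+(x\prec y)\rhd_1z=x\lhd_1(y\rhd_1z)+x\rhd_1(y\rhd_1z)$; $(x\lhd_1y)\lhd_2z+(x\lhd_1y)\rhd_2z=x\lhd_1(y\rhd_2z)+x\rhd_1(y\rhd_2z)$; $(x\lhd_2y)\lhd_2z+(x\lhd_2y)\rhd_2z=x\lhd_2(y\succ z)+x\rhd_2(y\succ z)$. *)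

(* Defs.v *)
From HB Require Import structures.
From mathcomp Require Import all_boot all_order all_algebra.

Set Implicit Arguments.
Unset Strict Implicit.
Unset Printing Implicit Defensive.

Import GRing.Theory.
Local Open Scope ring_scope.

Section Definitions.

Variable k : fieldType.

Definition bilinear_op (A : vectType k) (op : A -> A -> A) : Prop :=
  bilinear_for *:%R *:%R op.

Definition sum_op (A : vectType k) (op1 op2 : A -> A -> A) : A -> A -> A :=
  fun x y => op1 x y + op2 x y.

Record nc_Novikov (A : vectType k) (prec succ : A -> A -> A) : Prop := {
  nov_prec_bilinear : bilinear_op prec;
  nov_succ_bilinear : bilinear_op succ;
  nov_succ_prec : forall x y z,
    prec (succ x y) z = succ x (prec y z);
  nov_prec_bullet : let bullet := sum_op prec succ in forall x y z,
    bullet (prec x y) z = bullet x (succ y z)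
}.

Record nc_Novikov_rep (A : vectType k) (prec succ : A -> A -> A)
    (V : vectType k) (lprec rprec lsucc rsucc : 'Hom(A, 'End(V))) : Prop := {
  rep_lprec_succ : forall x y,
    lprec (succ x y) = (lsucc x \o lprec y)%VF;
  rep_rprec_lsucc : forall x y,
    (rprec x \o lsucc y)%VF = (lsucc y \o rprec x)%VF;
  rep_rprec_rsucc : forall x y,
    (rprec x \o rsucc y)%VF = rsucc (prec y x);
  rep_lbullet_prec : let lbullet := lprec + lsucc in forall x y,
    lbullet (prec x y) = (lbullet x \o lsucc y)%VF;
  rep_rbullet_lprec :
    let lbullet := lprec + lsucc in let rbullet := rprec + rsucc in
    forall x y, (rbullet x \o lprec y)%VF = (lbullet y \o rsucc x)%VF;
  rep_rbullet_rprec : let rbullet := rprec + rsucc in forall x y,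
    (rbullet x \o rprec y)%VF = rbullet (succ y x)
}.

Record O_operator (A : vectType k) (prec succ : A -> A -> A)
    (V : vectType k) (lprec rprec lsucc rsucc : 'Hom(A, 'End(V)))
    (T : 'Hom(V, A)) : Prop := {
  Oop_prec : forall u v,
    prec (T u) (T v) = T (lprec (T u) v + rprec (T v) u);
  Oop_succ : forall u v,
    succ (T u) (T v) = T (lsucc (T u) v + rsucc (T v) u)
}.

Record nc_pre_Novikov (A : vectType k)
    (lhd1 lhd2 rhd1 rhd2 : A -> A -> A) : Prop := {
  pre_lhd1_bilinear : bilinear_op lhd1;
  pre_lhd2_bilinear : bilinear_op lhd2;
  pre_rhd1_bilinear : bilinear_op rhd1;
  pre_rhd2_bilinear : bilinear_op rhd2;
  pre_succ_lhd1 : let succ := sum_op rhd1 rhd2 in forall x y z,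
    lhd1 (succ x y) z = rhd1 x (lhd1 y z);
  pre_rhd1_lhd2 : forall x y z,
    lhd2 (rhd1 x y) z = rhd1 x (lhd2 y z);
  pre_rhd2_lhd2 : let prec := sum_op lhd1 lhd2 in forall x y z,
    lhd2 (rhd2 x y) z = rhd2 x (prec y z);
  pre_prec_1 : let prec := sum_op lhd1 lhd2 in forall x y z,
    lhd1 (prec x y) z + rhd1 (prec x y) z
      = lhd1 x (rhd1 y z) + rhd1 x (rhd1 y z);
  pre_lhd1_2 : forall x y z,
    lhd2 (lhd1 x y) z + rhd2 (lhd1 x y) z
      = lhd1 x (rhd2 y z) + rhd1 x (rhd2 y z);
  pre_lhd2_2 : let succ := sum_op rhd1 rhd2 in forall x y z,
    lhd2 (lhd2 x y) z + rhd2 (lhd2 x y) z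
      = lhd2 x (succ y z) + rhd2 x (succ y z)
}.

End Definitions.

(* Main.v *)
Require Import Defs.
From HB Require Import structures.
From mathcomp Require Import all_boot all_order all_algebra.

(** Each of the six pre-Novikov identities is one of the six representation
    axioms, evaluated at a vector of [V], with the elements of [A] taken in the
    image of [T].  In an identity between products of [x], [y], [z], exactly one
    argument is acted upon and the other two act through [T].  If this argument
    is [y], the identity is a commutation rule between left and right actions.
    If it is [z] (resp. [x]), the other two act from the same side, and their
    product appears as a sum of two of the new operations; the O-operator
    equation says that [T] maps this sum to the product in [A], so that the
    identity becomes a rule for the left (resp. right) action of a product. *)

Set Implicit Arguments.
Unset Strict Implicit.
Unset Printing Implicit Defensive.

Import GRing.Theory.
Local Open Scope ring_scope.

(** This covers all four operations: the right actions give the same map with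
    its arguments exchanged. *)
Lemma bilinear_act (k : fieldType) (A V W : vectType k)
    (f : 'Hom(A, 'Hom(V, W))) (T : 'Hom(V, A)) :
  bilinear_for *:%R *:%R (fun u v : V => f (T u) v).
Proof.
split=> [v a u u' | u a v v'] /=; last by rewrite linearP.
by rewrite !linearP add_lfunE scale_lfunE.
Qed.

Lemma bilinear_flip (k : fieldType) (V W : vectType k) (op : V -> V -> W) :
  bilinear_for *:%R *:%R op -> bilinear_for *:%R *:%R (fun u v => op v u).
Proof. by case=> opl opr; split=> [v | u]; [apply: opr | apply: opl]. Qed.

Theorem proposition4p3 (k : fieldType) (char_k : [pchar k] =i pred0)
    (A : vectType k) (prec succ : A -> A -> A)
    (novA : nc_Novikov prec succ)
    (V : vectType k) (lprec rprec lsucc rsucc : 'Hom(A, 'End(V)))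
    (repV : nc_Novikov_rep prec succ lprec rprec lsucc rsucc)
    (T : 'Hom(V, A))
    (OT : O_operator prec succ lprec rprec lsucc rsucc T) :
  nc_pre_Novikov
    (fun u v : V => lprec (T u) v)
    (fun u v : V => rprec (T v) u)
    (fun u v : V => lsucc (T u) v)
    (fun u v : V => rsucc (T v) u).
Proof.
case: repV => lprecS rprec_lsucc rprec_rsucc lbulP rbul_lprec rbul_rprec.
case: OT => Tprec Tsucc.
split.
- exact: bilinear_act.
- exact: (bilinear_flip (bilinear_act rprec T)).
- exact: bilinear_act.
- exact: (bilinear_flip (bilinear_act rsucc T)).
- by move=> succV x y z; rewrite /succV /sum_op -Tsucc lprecS comp_lfunE.
- by move=> x y z; rewrite -comp_lfunE rprec_lsucc comp_lfunE.
- by move=> precV x y z; rewrite /precV /sum_op -Tprec -comp_lfunE rprec_rsucc.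
- move=> precV x y z; rewrite /precV /sum_op -Tprec.
  have /lfunP/(_ z) := lbulP (T x) (T y).
  by rewrite comp_lfunE !add_lfunE.
- move=> x y z; have /lfunP/(_ y) := rbul_lprec (T z) (T x).
  by rewrite !comp_lfunE !add_lfunE.
- move=> succV x y z; rewrite /succV /sum_op -Tsucc.
  have /lfunP/(_ x) := rbul_rprec (T z) (T y).
  by rewrite comp_lfunE !add_lfunE.
Qed.
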